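(* Let $n$ and $k$ be positive integers and let $0\leq r\leq n$. Let $A$ be a subset of $[k]_{r}^{n}$, and let $B$ be the initial segment of the $\leq$-order in $[k]_{r}^{n}$ with $|B|=|A|$. Then $|d(A)|\geq|d(B)|$.
   Context: Here $[k]=\{0,1,\dots,k-1\}$ and $[k]^{n}=\{0,\dots,k-1\}^{n}$ is the set of sequences $x=x_{1}\dots x_{n}$ with each $x_i\in[k]$. The rank of $x\in[k]^n$ is $w(x)=|\{i:x_{i}\geq1\}|$, and $[k]_{r}^{n}=\{x\in[k]^{n}:w(x)=r\}$ is the set of points with exactly $r$ non-zero coordinates. $d$-shadow: for $x\in[k]^{n}$, $d(\{x\})$ is the set of all points obtained from $x$ by changing exactly one non-zero coordinate of $x$ (i.e. one coordinate with value in $\{1,\dots,k-1\}$) to $0$. For $A\subseteq[k]^{n}$, $d(A)=\bigcup_{x\in A}d(\{x\})$. For example $d(\{012\})=\{002,010\}$ and $d(\{000\})=\emptyset$. The $\leq$-order: for $x\in[k]^{n}$ and $i\in[k]$ let $R_{i}(x)=\{j\in\{1,\dots,n\}:x_{j}=i\}$. The total order $\leq$ on $[k]^{n}$ is defined by setting $x\leq y$ if $x=y$ or one of the following holds: (1) $|R_{0}(x)|>|R_{0}(y)|$; (2) $|R_{0}(x)|=|R_{0}(y)|$ and, for the largest $i$ satisfying $R_{i}(x)\neq R_{i}(y)$, we have $\max\left(R_{i}(x)\,\Delta\,R_{i}(y)\right)\in R_{i}(y)$, where $\Delta$ denotes symmetric difference. The $\leq$-order in $[k]_{r}^{n}$ is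 the restriction of this order to $[k]_{r}^{n}$ (on which $|R_0|=n-r$ is constant, so only condition (2) is relevant). An initial segment of the $\leq$-order in $[k]_r^n$ is a set $B\subseteq[k]_r^{n}$ such that $y\in B$, $x\in[k]_r^n$ and $x\leq y$ imply $x\in B$. *)

(* Defs.v *)
From mathcomp Require Import all_boot.

Set Implicit Arguments.
Unset Strict Implicit.
Unset Printing Implicit Defensive.

(* Coordinates are indexed by 0, ..., n-1 instead of 1, ..., n; only the order
   of the positions is used below. *)
Definition point (k n : nat) := {ffun 'I_n -> 'I_k}.

Section Points.

Variables k n : nat.
Implicit Types (x y : point k n) (A B : {set point k n}).

Definition rank x : nat := #|[set j : 'I_n | 1 <= x j]|.

Definition layer (r : nat) : {set point k n} := [set x | rank x == r].

(* The value i is a natural number, so that 0 makes sense for every k. *)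
Definition Rset (i : nat) x : {set 'I_n} := [set j : 'I_n | x j == i :> nat].

(* y is x with exactly one non-zero coordinate, the one at j, replaced by 0. *)
Definition dshadow1 x : {set point k n} :=
  [set y : point k n | [exists j : 'I_n,
     [&& x j != 0 :> nat, y j == 0 :> nat
       & [forall l : 'I_n, (l != j) ==> (y l == x l)]]]].

Definition dshadow A : {set point k n} := \bigcup_(x in A) dshadow1 x.

Definition symdiff (S T : {set 'I_n}) : {set 'I_n} := (S :\: T) :|: (T :\: S).

(* The maximum of S exists and belongs to T. *)
Definition max_in (S T : {set 'I_n}) : bool :=
  [exists j : 'I_n,
     [&& j \in S, [forall l : 'I_n, (l \in S) ==> (l <= j)] & j \in T]].

Definition point_le x y : bool :=
  [|| x == y,
      #|Rset 0 x| > #|Rset 0 y|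
    | (#|Rset 0 x| == #|Rset 0 y|) &&
      [exists i : 'I_k,
         [&& Rset i x != Rset i y,
             [forall m : 'I_k, (i < m) ==> (Rset m x == Rset m y)]
           & max_in (symdiff (Rset i x) (Rset i y)) (Rset i y)]]].

Definition initial_segment (r : nat) B : Prop :=
  B \subset layer r /\
  forall x y, y \in B -> x \in layer r -> point_le x y -> x \in B.

End Points.

(* Main.v *)
(* Each point gets a numerical key, a sum of distinct powers of 2 with one term
   per non-zero coordinate, that linearises the order on every layer.  Equal
   coordinates contribute equally to two keys, so the order restricts well to
   the slices where the coordinates outside a set S are frozen, and the theorem
   is proved for all slices by induction on |S|.

   Compressing all the sections {x_i = v} of A into initial segments does not
   increase the shadow: the shadow of an initial segment is initial, and initial
   segments are nested.  When A is stable under these compressions without being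
   initial, let x be the first missing point and y the last point of A; they
   differ at every coordinate of S.  Let f(z) be the number of coordinates of z
   that are equal to 1 and preceded by no zero: adding x creates at most f(x)
   shadow points and removing y destroys at least f(y).  If f(x) <= f(y),
   replace y by x.  Otherwise no coordinate vanishes, x has a single 1, at some
   i, and 2 <= y_j < x_j for all j <> i; then for p <> i minimising y_p, replace
   the points y[p := w] with 1 <= w <= y_p by the points x[i := w]: one shadow
   point appears and one disappears.  Each step lowers the sum of the keys. *)

Require Import Defs.
From mathcomp Require Import all_boot.
From mathcomp Require Import zify.

Set Implicit Arguments.
Unset Strict Implicit.
Unset Printing Implicit Defensive.

Section Star.

Variables k n : nat.
Local Notation pt := (point k.+1 n).
Implicit Types (x y z u c : pt) (A B L X Y : {set pt}) (S : {set 'I_n}).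
Implicit Types (i j l p q : 'I_n) (v : 'I_k.+1).

(** * Keys *)

Definition upd x i (v : 'I_k.+1) : pt := [ffun j => if j == i then v else x j].

Lemma updE x i v j : upd x i v j = if j == i then v else x j.
Proof. by rewrite ffunE. Qed.

Lemma upd_same x i v : upd x i v i = v.
Proof. by rewrite updE eqxx. Qed.

Lemma upd_neq x i v j : j != i -> upd x i v j = x j.
Proof. by rewrite updE => /negPf ->. Qed.

Lemma upd_id x i : upd x i (x i) = x.
Proof. by apply/ffunP=> j; rewrite updE; case: eqP => [->|]. Qed.

Lemma upd_upd x i v w : upd (upd x i v) i w = upd x i w.
Proof. by apply/ffunP=> j; rewrite !updE; case: eqP. Qed.

Lemma updC x i j v w : i != j -> upd (upd x i v) j w = upd (upd x j w) i v.
Proof.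
move=> ij; apply/ffunP=> l; rewrite !updE.
by case: (eqVneq l j) => [->|//]; rewrite eq_sym (negPf ij).
Qed.

Lemma sum_upd (f : 'I_n -> nat -> nat) x i v :
  \sum_j f j (upd x i v j) + f i (x i) = \sum_j f j (x j) + f i v.
Proof.
rewrite (bigD1 i) //= [in RHS](bigD1 i) //= upd_same.
rewrite (eq_bigr (fun j => f j (x j))); first lia.
by move=> j ji; rewrite upd_neq.
Qed.

Lemma rankE x : rank x = \sum_j (0 < x j).
Proof.
rewrite /rank -sum1_card big_mkcond /=; apply: eq_bigr => j _.
by rewrite inE; case: (0 < x j).
Qed.

Lemma rank_upd x i v : rank (upd x i v) + (0 < x i) = rank x + (0 < v).
Proof. by rewrite !rankE (sum_upd (fun _ (m : nat) => 0 < m : nat)). Qed.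

(** Positions are below [n], so the exponents order the pairs (value, position) lexicographically.
    The factor [0 < v] makes zero coordinates weightless, so zeroing a coordinate subtracts exactly
    its power of 2. *)
Definition weight (j v : nat) : nat := (0 < v) * 2 ^ (v * n + j).

Definition key x : nat := \sum_(j < n) weight j (x j).

Lemma key_upd x i v : key (upd x i v) + weight i (x i) = key x + weight i v.
Proof. exact: (sum_upd (fun j : 'I_n => weight j)). Qed.

Definition lexlt (v j w i : nat) : bool := (v < w) || (v == w) && (j < i).

Lemma lexltE (v w : nat) j i : (v * n + j < w * n + i) = lexlt v j w i.
Proof.
rewrite /lexlt; have := ltn_ord i; have := ltn_ord j.
case: (ltngtP v w) => [vw|wv|->] /=; last by lia.
- move=> jn iN; apply/idP; have : v.+1 * n <= w * n by rewrite leq_mul2r vw orbT.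
  by lia.
- move=> jn iN; apply/negP => H; have : w.+1 * n <= v * n by rewrite leq_mul2r wv orbT.
  by lia.
Qed.

Lemma weight_lt (v w : nat) j i : 0 < w -> lexlt v j w i -> weight j v < weight i w.
Proof.
move=> w_gt0 lt_vw.
rewrite /weight w_gt0 mul1n; case: (posnP v) => [->|v_gt0].
  by rewrite mul0n expn_gt0.
by rewrite mul1n ltn_exp2l // lexltE.
Qed.

Lemma weight_ltv (v w : nat) j i : v < w -> weight j v < weight i w.
Proof. by move=> vw; apply: weight_lt; [lia | rewrite /lexlt vw]. Qed.

Lemma weight1_lt j i : j < i -> weight j 1 < weight i 1.
Proof. by move=> ji; apply: weight_lt; rewrite ?/lexlt ?ji. Qed.

(** Two powers of 2 with distinct exponents add up to less than twice the larger one, which is at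
    most any higher power. *)
Lemma weight_add_lt (v1 v2 v3 : nat) j1 j2 j3 : 0 < v2 ->
  lexlt v1 j1 v2 j2 -> lexlt v2 j2 v3 j3 ->
  weight j1 v1 + weight j2 v2 < weight j3 v3.
Proof.
move=> v2_gt0 lt12 lt23; have := weight_lt v2_gt0 lt12.
have v3_gt0 : 0 < v3 by move: lt23; rewrite /lexlt; lia.
rewrite /weight v2_gt0 v3_gt0 !mul1n => lt_w1.
apply: (@leq_trans (2 ^ (v2 * n + j2).+1)); last by rewrite leq_exp2l // lexltE.
by rewrite expnS mul2n -addnn ltn_add2r.
Qed.

(** Distinct non-zero coordinates have distinct exponents, so at most one of them attains the top
    exponent; the others are bounded by the next lower power of 2. *)
Lemma sum_weight_lt (P : pred 'I_n) x e :
  (forall j, P j -> 0 < x j -> x j * n + j < e) ->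
  \sum_(j | P j) weight j (x j) < 2 ^ e.
Proof.
elim: e P => [|e IH] P H.
  rewrite big1 ?expn_gt0 // => j Pj; rewrite /weight.
  by case: (posnP (x j)) => [->|/(H j Pj)].
rewrite expnS.
case: (pickP (fun j => [&& P j, 0 < x j & x j * n + j == e])) => [j0|Hno]; last first.
  have : \sum_(j | P j) weight j (x j) < 2 ^ e; last by lia.
  apply: IH => j Pj xj; have := H j Pj xj; have := Hno j; rewrite Pj xj /=; lia.
case/and3P=> Pj0 xj0 /eqP ej0; rewrite (bigD1 j0) //=.
have : \sum_(j | P j && (j != j0)) weight j (x j) < 2 ^ e.
  apply: IH => j /andP[Pj jj0] xj; have := H j Pj xj.
  have : x j * n + j != e; last by lia.
  apply: contraNneq jj0 => ej; apply/eqP/val_inj => /=.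
  have: ~~ (x j * n + j < x j0 * n + j0) by lia.
  have: ~~ (x j0 * n + j0 < x j * n + j) by lia.
  by rewrite !lexltE /lexlt; lia.
by rewrite [weight j0 _]/weight xj0 ej0 mul1n mul2n -addnn ltn_add2l.
Qed.

(** Coordinates where the points agree cancel. On the others every exponent of [x] is below that of
    [z] at [i], so this single power of 2 exceeds their sum. *)
Lemma key_lt_top x z i :
    x i != z i -> 0 < z i ->
    (forall j, x j != z j -> lexlt (x j) j (z i) i) ->
  key x < key z.
Proof.
move=> xzi zi0 H; rewrite /key (bigID (fun j => x j != z j)) /=.
rewrite [X in _ < X](bigID (fun j => x j != z j)) /=.
rewrite (eq_bigr (fun j => weight j (z j)) (P := fun j => ~~ (x j != z j))); last first.
  by move=> j /negPn/eqP ->.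
rewrite ltn_add2r (bigD1 i (P := fun j => x j != z j)) //=.
rewrite -(bigD1 i (P := fun j => x j != z j)) //=.
apply: (@leq_trans (2 ^ (z i * n + i))).
  by apply: sum_weight_lt => j xzj _; rewrite lexltE H.
by rewrite (bigD1 i) //= [weight i _]/weight zi0 mul1n leq_addr.
Qed.

(** Take for [i] the coordinate with the largest exponent of [y] among those where the points
    differ. If some differing coordinate of [x] were not below it, [key_lt_top] would reverse the
    inequality. *)
Lemma key_top x y :
    key x < key y ->
  exists i, [/\ x i != y i, 0 < y i,
    forall j, x j != y j -> lexlt (x j) j (y i) i
    & forall j, x j != y j -> ~~ lexlt (y i) i (y j) j].
Proof.
move=> kxy; pose D := [set j | (x j != y j) && (0 < y j)].
case: (set_0Vmem D) => [D0|[i0 i0D]].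
  suff: key y <= key x by rewrite leqNgt kxy.
  apply: leq_sum => j _; move/setP/(_ j): D0; rewrite !inE.
  by case: eqP => [->//|_] /=; rewrite lt0n => /negPn/eqP ->.
pose i := [arg max_(j > i0 in D) (y j * n + j)].
have [iD iM] : i \in D /\ forall j, j \in D -> y j * n + j <= y i * n + i.
  by rewrite /i; case: arg_maxnP => // i1.
move: (iD); rewrite inE => /andP[xyi yi0].
have iM2 j : x j != y j -> ~~ lexlt (y i) i (y j) j.
  move=> xyj; case: (posnP (y j)) => [->|yj0]; first by rewrite /lexlt; lia.
  by rewrite -lexltE -leqNgt iM // inE xyj.
exists i; split => // j xyj; apply: contraT => nlex.
have nxy : ~~ (key y < key x) by rewrite -leqNgt ltnW.
case/negP: nxy; apply: (@key_lt_top y x j); first by rewrite eq_sym.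
  by move: nlex; rewrite /lexlt; lia.
move=> j'; rewrite eq_sym => xyj'; have := iM2 _ xyj'.
case: (eqVneq j i) => [ji|ji].
  move: xyj nlex; rewrite ji -val_eqE /lexlt /=; lia.
by move: ji nlex; rewrite -val_eqE /lexlt /=; lia.
Qed.

(** At the coordinate of disagreement with the largest exponent over both points, the larger value
    decides the comparison of the keys. *)
Lemma key_inj x y : key x = key y -> x = y.
Proof.
move=> kxy; apply/eqP; case: (pickP (fun j => x j != y j)) => [j0 j0D|H]; last first.
  by apply/eqP/ffunP=> j; apply/eqP/negPn; rewrite H.
pose e j := maxn (x j) (y j) * n + j.
pose i := [arg max_(j > j0 | x j != y j) e j].
have [iD iM] : x i != y i /\ forall j, x j != y j -> e j <= e i.
  by rewrite /i; case: arg_maxnP => // i1.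
have iM' j : x j != y j -> ~~ lexlt (maxn (x i) (y i)) i (maxn (x j) (y j)) j.
  by move=> jD; rewrite -lexltE -leqNgt iM.
exfalso; case: (ltngtP (x i) (y i)) => [lti|gti|eqi].
- have := @key_lt_top x y i iD; rewrite kxy ltnn => H; suff: false by []; apply: H; first lia.
  move=> j jD; move: (jD) (iM' j jD); case: (eqVneq j i) => [->|].
    by rewrite /lexlt lti.
  by rewrite -!val_eqE /lexlt /=; lia.
- have := @key_lt_top y x i; rewrite kxy ltnn => H; suff: false by [].
  apply: H; [by rewrite eq_sym|lia|].
  move=> j; rewrite eq_sym => jD; move: (jD) (iM' j jD); case: (eqVneq j i) => [->|].
    by rewrite /lexlt gti.
  by rewrite -!val_eqE /lexlt /=; lia.
- by move/eqP: iD; apply; apply: val_inj.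
Qed.

(** * Slices, shadows and initial segments *)

(* S is the set of free coordinates; the others are frozen to those of c. *)
Definition slice S c (r : nat) : {set pt} :=
  [set x | (rank x == r) && [forall j, (j \notin S) ==> (x j == c j)]].

Lemma sliceP S c r x :
  reflect (rank x = r /\ forall j, j \notin S -> x j = c j) (x \in slice S c r).
Proof.
rewrite inE; apply: (iffP andP) => -[/eqP rx Hx]; split=> //; try exact/eqP.
  by move=> j jS; move/forallP/(_ j)/implyP: Hx => /(_ jS)/eqP.
by apply/forallP=> j; apply/implyP=> jS; apply/eqP/Hx.
Qed.

Lemma slice_upd S c r r' x i v :
    x \in slice S c r -> i \in S -> r' + (0 < x i) = r + (0 < v) ->
  upd x i v \in slice S c r'.
Proof.
case/sliceP=> rx Hx iS rr'; apply/sliceP; split.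
  by have := rank_upd x i v; lia.
by move=> j jS; rewrite upd_neq ?Hx //; apply: contraNneq jS => ->.
Qed.

Definition shad S A : {set pt} :=
  [set u | [exists x in A, [exists j in S, (0 < x j) && (u == upd x j ord0)]]].

Lemma shadP S A u :
  reflect (exists x j, [/\ x \in A, j \in S, 0 < x j & u = upd x j ord0])
          (u \in shad S A).
Proof.
rewrite inE; apply: (iffP exists_inP).
  by case=> x xA /exists_inP[j jS /andP[xj /eqP->]]; exists x, j.
by case=> x [j [xA jS xj ->]]; exists x => //; apply/exists_inP; exists j; rewrite ?xj ?eqxx.
Qed.

Lemma mem_shad S A x j :
  x \in A -> j \in S -> 0 < x j -> upd x j ord0 \in shad S A.
Proof. by move=> xA jS xj; apply/shadP; exists x, j. Qed.

Lemma shad_slice S c r A :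
  A \subset slice S c r -> shad S A \subset slice S c r.-1.
Proof.
move/subsetP=> AL; apply/subsetP=> _ /shadP[x [j [/AL xL jS xj ->]]].
apply: (slice_upd xL jS); have /sliceP[<- _] := xL.
by have := rank_upd x j ord0; rewrite xj /=; lia.
Qed.

Definition initial L B : Prop :=
  B \subset L /\ forall x y, y \in B -> x \in L -> key x <= key y -> x \in B.

Lemma initial_exists L m : m <= #|L| -> exists B, initial L B /\ #|B| = m.
Proof.
elim: m => [_|m IH mL].
  by exists set0; rewrite cards0; split=> //; split=> [|x y]; rewrite ?sub0set ?inE.
case: (IH (ltnW mL)) => B [[BL Bi] cB].
have [x0 x0D] : exists x0, x0 \in L :\: B.
  by apply/set0Pn; rewrite -card_gt0 cardsD (setIidPr BL) cB subn_gt0.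
pose x := [arg min_(x < x0 in L :\: B) key x].
have [/setDP[xL xB] xM] : x \in L :\: B /\ forall y, y \in L :\: B -> key x <= key y.
  by rewrite /x; case: arg_minnP => // i1.
exists (x |: B); split; last by rewrite cardsU1 xB cB.
split=> [|u y]; first by apply/subsetP=> u /setU1P[->//|/(subsetP BL)].
move=> /setU1P yB uL uy; apply/setU1P; case: (boolP (u \in B)) => [|uB]; first by right.
left; case: yB => [yx|yB]; last by rewrite (Bi _ _ yB uL uy) in uB.
by apply/key_inj/eqP; rewrite eqn_leq -{1}yx uy xM // inE uB.
Qed.

Lemma initial_sub L A B : initial L A -> initial L B -> #|A| <= #|B| -> A \subset B.
Proof.
move=> [AL Ai] [BL Bi] cAB; apply/subsetP=> x xA; apply: contraLR cAB => xB.
rewrite -ltnNge; apply: proper_card; apply/properP; split; last by exists x.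
apply/subsetP=> y yB; apply: (Ai _ _ xA (subsetP BL _ yB)); rewrite leqNgt.
by apply: contra xB => /ltnW; apply: (Bi _ _ yB (subsetP AL _ xA)).
Qed.

Definition wt A : nat := \sum_(x in A) key x.

Lemma exchange_card A X Y :
  Y \subset A -> [disjoint X & A] -> #|X| = #|Y| -> #|(A :\: Y) :|: X| = #|A|.
Proof.
move=> YA dXA cXY; rewrite cardsU cardsD (setIidPr YA).
have -> : (A :\: Y) :&: X = set0.
  apply/setP=> z; rewrite !inE; apply/negP=> /andP[/andP[_ zA] zX].
  by have /pred0P/(_ z) := dXA; rewrite /= zX zA.
by rewrite cards0; have := subset_leq_card YA; lia.
Qed.

Lemma exchange_wt A X Y :
    Y \subset A -> [disjoint X & A] -> #|X| = #|Y| -> 0 < #|Y| ->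
    (forall x y, x \in X -> y \in Y -> key x < key y) ->
  wt ((A :\: Y) :|: X) < wt A.
Proof.
move=> YA dXA cXY Y0 kXY; rewrite /wt [X in _ < X](big_setID Y) /= (setIidPr YA).
rewrite [X in X < _](eq_bigl [in [predU A :\: Y & X]]); last by move=> z; rewrite !inE.
rewrite bigU /=; last by rewrite disjoint_sym; apply: (disjointWr _ dXA); exact: subsetDl.
rewrite addnC ltn_add2r.
case/card_gt0P: Y0 => y0 y0Y.
(* The least key of [Y] separates the sums: each key of [X] is at most [(key y).-1], each key of [Y]
   at least [key y]. *)
pose y := [arg min_(y < y0 in Y) key y].
have [yY yM] : y \in Y /\ forall z, z \in Y -> key y <= key z.
  by rewrite /y; case: arg_minnP.
apply: (@leq_trans (#|Y| * key y)); last by rewrite -sum_nat_const; apply: leq_sum.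
have X0 : 0 < #|X| by rewrite cXY; apply/card_gt0P; exists y0.
have ky : 0 < key y.
  by case/card_gt0P: X0 => x xX; apply: leq_ltn_trans (kXY _ _ xX yY).
apply: (@leq_ltn_trans (#|X| * (key y).-1)).
  rewrite -sum_nat_const; apply: leq_sum => x xX.
  by have := kXY _ _ xX yY; lia.
by rewrite -cXY ltn_pmul2l //; lia.
Qed.

(** [B] arises from [A] by exchanging [A :\: B] for [B :\: A], and initiality places the latter
    below the former. *)
Lemma initial_wt L A B :
  initial L B -> A \subset L -> #|A| = #|B| -> A != B -> wt B < wt A.
Proof.
move=> [BL Bi] AL cAB nAB.
have cD : #|B :\: A| = #|A :\: B| by rewrite !cardsD [A :&: B]setIC; lia.
have -> : B = (A :\: (A :\: B)) :|: (B :\: A).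
  by apply/setP=> z; rewrite !inE; case: (z \in A); case: (z \in B).
apply: exchange_wt => //; first exact: subsetDl.
- by rewrite -setI_eq0; apply/eqP/setP=> z; rewrite !inE; case: (z \in A); rewrite ?andbF.
- rewrite card_gt0; apply: contra nAB; rewrite setD_eq0 => AB.
  by rewrite eqEcard AB cAB leqnn.
- move=> x y /setDP[xB xA] /setDP[yA yB]; rewrite ltnNge; apply: contra yB.
  by apply: (Bi _ _ xB (subsetP AL _ yA)).
Qed.

(* Junk value 0 when k = 0; then every coordinate is 0. *)
Definition one_k : 'I_k.+1 := inord 1.

Lemma one_kE v : 0 < v -> one_k = 1 :> nat.
Proof. by move=> v_gt0; rewrite inordK //; have := ltn_ord v; lia. Qed.

(** Raising the first free zero of [u] to 1 gives the least point of the slice that has [u] in its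
    shadow. It is compared with [w] raised in the same way, which is at most the point [y] of [B]
    above [w]. *)
Lemma initial_shad S c r B :
  initial (slice S c r) B -> initial (slice S c r.-1) (shad S B).
Proof.
case=> BL Bi; split; first exact: shad_slice.
move=> u w /shadP[y [j [yB jS yj defw]]] uL uw.
have yL := subsetP BL _ yB; have /sliceP[ry Hy] := yL.
have wL : w \in slice S c r.-1.
  by apply: (subsetP (shad_slice BL)); rewrite defw; exact: mem_shad.
have /sliceP[rw Hw] := wL; have /sliceP[ru Hu] := uL.
have wj : w j = ord0 by rewrite defw upd_same.
have r0 : 0 < r by have := rank_upd y j ord0; rewrite -ry yj /=; lia.
(* Without a free zero, [u] would have larger rank than [w], which vanishes at [j]. *)
have [l0 l0S /eqP ul0] : exists2 l, l \in S & u l == ord0.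
  apply/exists_inP; apply: contraT; rewrite negb_exists_in => /forall_inP Hn.
  suff: rank w < rank u by rewrite rw ru ltnn.
  rewrite !rankE (bigD1 j) //= [X in _ < X](bigD1 j) //= wj /=.
  have -> : 0 < u j by move: (Hn _ jS); rewrite -val_eqE /=; lia.
  rewrite add0n add1n ltnS; apply: leq_sum => i _.
  case: (boolP (i \in S)) => [/Hn|iS]; last by rewrite Hw // Hu.
  by rewrite -val_eqE /=; case: (w i) (u i) => [[|?] ?] [[|?] ?].
have first_zero (x : pt) q0 : q0 \in S -> x q0 = ord0 ->
    exists l, [/\ l \in S, x l = ord0 & forall q, q \in S -> x q = ord0 -> l <= q].
  move=> q0S xq0; pose l := [arg min_(l < q0 | (l \in S) && (x l == ord0)) (l : nat)].
  have [/andP[lS /eqP xl] lM] :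
     (l \in S) && (x l == ord0) /\ forall q, (q \in S) && (x q == ord0) -> l <= q.
    by rewrite /l; case: arg_minnP => //; rewrite q0S xq0 eqxx.
  by exists l; split=> // q qS xq; apply: lM; rewrite qS xq eqxx.
have [l [lS ul lM]] := first_zero u l0 l0S ul0.
have [l' [l'S wl' l'M]] := first_zero w j jS wj.
have v1 := one_kE yj.
have w0 q : weight q 0 = 0 by rewrite /weight mul0n.
have uK : upd (upd u l one_k) l ord0 = u by rewrite upd_upd -{2}(upd_id u l) ul.
rewrite -uK; apply: mem_shad => //; last by rewrite upd_same v1.
have xL : upd u l one_k \in slice S c r.
  by apply: (slice_upd uL lS); rewrite ul v1 addn0 addn1 prednK.
have w'L : upd w l' one_k \in slice S c r by apply: slice_upd wL l'S _; rewrite wl' v1 /=; lia.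
apply: (Bi _ _ yB xL); apply: (@leq_trans (key (upd w l' one_k))); last first.
  have k1 := key_upd w l' one_k; have k2 := key_upd y j ord0.
  rewrite wl' v1 /= in k1; rewrite -defw /= in k2.
  have : weight l' 1 <= weight j (y j).
    move: (l'M _ jS wj); rewrite leq_eqVlt => /orP[/eqP E|lt].
      rewrite E; move: yj; rewrite leq_eqVlt => /orP[/eqP<-//|yj2].
      exact/ltnW/weight_ltv.
    apply: ltnW; apply: weight_lt => //; rewrite /lexlt lt andbT.
    by move: yj; rewrite leq_eqVlt orbC.
  by move: k1 k2; rewrite !w0 !addn0; clear; lia.
have [uw_eq|nuw] := eqVneq u w.
  suff -> : l = l' by rewrite uw_eq.
  by apply/val_inj/eqP; rewrite /= eqn_leq lM // ?l'M // -?uw_eq // uw_eq.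
have ltuw : key u < key w.
  by rewrite ltn_neqAle uw andbT; apply: contra nuw => /eqP/key_inj->.
have k1 := key_upd u l one_k; have k2 := key_upd w l' one_k.
rewrite ul v1 w0 addn0 in k1; rewrite wl' v1 w0 addn0 in k2.
case: (leqP l l') => [ll'|l'l].
  suff : weight l 1 <= weight l' 1 by move: k1 k2 uw; clear; lia.
  by move: ll'; rewrite leq_eqVlt => /orP[/eqP->//|/weight1_lt/ltnW].
have ul'0 : 0 < u l'.
  rewrite lt0n; apply: contraTneq l'l => ul'0; rewrite -leqNgt; apply: lM => //.
  exact/val_inj.
have [i [uwi wi0 iT iM]] := key_top ltuw.
have il' : i != l' by apply: contraTneq wi0 => ->; rewrite wl'.
have wil' : upd w l' one_k i = w i by rewrite upd_neq.
have uwl' : u l' != w l' by apply: contraTneq ul'0; rewrite wl' => ->.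
(* The 1 added at [l] weighs less than [w] does at [i], so [i] still decides the comparison. *)
have [wi2|wi1] := boolP ((1 < w i) || (l < i)).
  apply/ltnW/(@key_lt_top _ _ i); rewrite ?wil' //.
    rewrite updE; case: (eqVneq i l) => [il|//]; apply: contraTneq wi2 => vi.
    by rewrite -vi v1 il !ltnn.
  move=> q; rewrite !updE; case: (eqVneq q l) => [->|ql].
    by rewrite v1 /lexlt; move: wi2 wi0; clear; lia.
  by case: (eqVneq q l') => [->|ql' /iT//]; rewrite iT.
(* What remains is [i = l] with [w l = 1], and then the two raised points coincide: both are 1 at
   [l] and at [l'], they can differ elsewhere only by values 0 and 1, and equal ranks force equal
   supports. *)
move: wi1; rewrite negb_or -leqNgt -leqNgt => /andP[wi_le1 il].
have wi1 : w i = 1 :> nat by move: wi_le1 wi0; clear; lia.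
have ui0 : u i = ord0.
  apply/val_inj => /=; move: (iT i uwi) (uwi); rewrite /lexlt ltnn andbF orbF wi1.
  by clear; lia.
have iS : i \in S by apply: contraNT uwi => iS; rewrite Hu ?Hw.
have {}il : i = l by apply/val_inj/eqP; rewrite /= eqn_leq il lM.
have ul'1 : u l' = one_k.
  apply/val_inj => /=; rewrite v1; move: (iT l' uwl') (ul'0); rewrite /lexlt wi1.
  by clear; lia.
have le1 q : q != l -> q != l' -> u q != w q ->
    (u q <= 1) && (w q <= 1) && ((0 < w q) ==> (0 < u q)).
  move=> ql ql' uwq; have qS : q \in S by apply: contraNT uwq => qS; rewrite Hu ?Hw.
  have uq0 : ~~ (0 < u q) -> l <= q by rewrite -eqn0Ngt => /eqP uq; apply/lM/val_inj.
  move: (iT q uwq) (iM q uwq) uq0 ql; rewrite il -val_eqE /lexlt -il wi1 /=.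
  by clear; lia.
suff -> : upd u l one_k = upd w l' one_k by [].
have supp : [set q | 0 < upd w l' one_k q] = [set q | 0 < upd u l one_k q].
  apply/eqP; rewrite eqEcard; have /sliceP[rx _] := xL; have /sliceP[rw' _] := w'L.
  rewrite /rank in rx rw'; rewrite rx rw' leqnn andbT.
  apply/subsetP=> q; rewrite !inE !updE.
  case: (eqVneq q l) => [_|ql]; first by rewrite v1.
  case: (eqVneq q l') => [-> _|ql' wq]; first exact: ul'0.
  case: (eqVneq (u q) (w q)) => [->//|uwq].
  by case/andP: (le1 q ql ql' uwq) => _ /implyP; apply.
apply/ffunP=> q; move/setP/(_ q): supp; rewrite !inE !updE.
case: (eqVneq q l) => [->|ql].
  by case: eqP => [//|_ _]; rewrite -il; apply: val_inj; rewrite /= v1 wi1.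
case: (eqVneq q l') => [->//|ql'].
case: (eqVneq (u q) (w q)) => [//|uwq] supp.
case/andP: (le1 q ql ql' uwq) => /andP[u1 w1] _.
by apply: val_inj => /=; move: u1 w1 supp; clear; lia.
Qed.

(** * Compression *)

Definition section A i v : {set pt} := [set x in A | x i == v].

Lemma card_sections A i : #|A| = \sum_v #|section A i v|.
Proof.
rewrite -sum1_card (partition_big (fun x => x i) xpredT) //=; apply: eq_bigr => v _.
by rewrite -sum1_card; apply: eq_bigl => x; rewrite inE.
Qed.

Lemma wt_sections A i : wt A = \sum_v wt (section A i v).
Proof.
rewrite /wt (partition_big (fun x => x i) xpredT) //=; apply: eq_bigr => v _.
by apply: eq_bigl => x; rewrite inE.
Qed.

Lemma section_slice S c r A i v :
  A \subset slice S c r -> section A i v \subset slice (S :\ i) (upd c i v) r.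
Proof.
move/subsetP=> AL; apply/subsetP=> x; rewrite inE => /andP[/AL/sliceP[rx Hx] /eqP xi].
apply/sliceP; split=> // j; rewrite !inE negb_and negbK updE.
by case: (eqVneq j i) => [->//|_] /=; apply: Hx.
Qed.

Lemma section_shad S A i v : i \in S -> 0 < v ->
  section (shad S A) i v = shad (S :\ i) (section A i v).
Proof.
move=> iS v0; apply/setP=> u; rewrite inE; apply/andP/shadP.
  case=> /shadP[x [j [xA jS xj ->]]]; rewrite updE.
  case: (eqVneq i j) => [_|ij]; first by move=> /eqP vE; rewrite -vE in v0.
  by move=> xi; exists x, j; rewrite !inE xA xi jS eq_sym ij.
case=> x [j [/setIdP[xA /eqP xi] /setD1P[ji jS] xj ->]].
rewrite eq_sym in ji; rewrite (upd_neq _ _ ji) xi eqxx; split=> //.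
exact: mem_shad.
Qed.

(** The contribution of the section at [v] to the shadow points that vanish at [i]: for [v = 0]
    another coordinate was zeroed, otherwise it was [i] itself. *)
Definition shad_part S A i v : {set pt} :=
  if v == ord0 then shad (S :\ i) (section A i v)
  else [set upd x i ord0 | x in section A i v].

Lemma section_shad0 S A i : i \in S ->
  section (shad S A) i ord0 = \bigcup_v shad_part S A i v.
Proof.
move=> iS; apply/setP=> u; rewrite inE; apply/andP/bigcupP.
  case=> /shadP[x [j [xA jS xj ->]]]; rewrite updE => Hi.
  exists (x i) => //; rewrite /shad_part; case: (eqVneq i j) Hi => [-> _|ij xi].
    case: eqP => [xj0|_]; first by rewrite xj0 in xj.
    by apply/imsetP; exists x; rewrite // inE xA /=.
  by rewrite xi; apply: mem_shad; rewrite ?inE ?xA ?eqxx // eq_sym ij.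
case=> v _; rewrite /shad_part; case: eqP => [->|/eqP v0].
  case/shadP=> x [j [/setIdP[xA /eqP xi] /setD1P[ji jS] xj ->]].
  rewrite eq_sym in ji; rewrite (upd_neq _ _ ji) xi; split=> //.
  exact: mem_shad.
case/imsetP=> x; rewrite inE => /andP[xA /eqP xi] ->; rewrite upd_same; split=> //.
by apply: mem_shad => //; rewrite xi lt0n.
Qed.

(** Zeroing a coordinate frozen at [v] lowers all keys by the same amount, so it preserves their
    order. *)
Lemma initial_upd0 S c r i v B : i \notin S -> 0 < v ->
    initial (slice S (upd c i v) r) B ->
  initial (slice S (upd c i ord0) r.-1) [set upd x i ord0 | x in B].
Proof.
move=> iS v0 [BL Bi].
have Bv x : x \in slice S (upd c i v) r -> x i = v.
  by case/sliceP=> _ /(_ i iS) ->; rewrite upd_same.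
split.
  apply/subsetP=> _ /imsetP[x xB ->]; have xL := subsetP BL _ xB.
  have xi := Bv _ xL; case/sliceP: xL => rx Hx; apply/sliceP; split.
    by have := rank_upd x i ord0; rewrite xi v0 rx /=; lia.
  by move=> j jS; have := Hx j jS; rewrite !updE; case: eqP.
move=> x _ /imsetP[y yB ->] xL kxy; have yL := subsetP BL _ yB.
have yi := Bv _ yL; case/sliceP: (yL) => ry Hy; case/sliceP: (xL) => rx Hx.
have xi : x i = ord0 by rewrite Hx // upd_same.
have xE : x = upd (upd x i v) i ord0 by rewrite upd_upd -xi upd_id.
rewrite xE; apply: imset_f; apply: (Bi _ _ yB).
  apply/sliceP; split.
    have := rank_upd x i v; have := rank_upd y i ord0.
    by rewrite xi yi v0 ry rx /=; lia.
  by move=> j jS; move: (Hx j jS); rewrite !updE; case: eqP.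
have := key_upd x i v; have := key_upd y i ord0; rewrite xi yi.
by move: kxy; clear; lia.
Qed.

(** Initial segments of one slice are nested, so the union of the [T a] is the largest of them. *)
Lemma card_bigcup_initial (I : finType) L (T U : I -> {set pt}) :
    (forall a, initial L (T a)) -> (forall a, #|T a| <= #|U a|) ->
  #|\bigcup_a T a| <= #|\bigcup_a U a|.
Proof.
move=> Ti TU; case: (pickP (@predT I)) => [a0 _|I0]; last first.
  by rewrite big_pred0 ?cards0 // => a; have := I0 a.
pose a := [arg max_(a > a0) #|T a|].
have aM b : #|T b| <= #|T a| by rewrite /a; case: arg_maxnP => // ? _; apply.
apply: (@leq_trans #|T a|).
  by apply/subset_leq_card/bigcupsP=> b _; exact: (initial_sub (Ti b) (Ti a)).
by apply: (leq_trans (TU a)); apply/subset_leq_card; exact: (bigcup_sup a).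
Qed.

Definition shadow_optimal S : Prop := forall c r A B,
  A \subset slice S c r -> initial (slice S c r) B -> #|B| = #|A| ->
  #|shad S B| <= #|shad S A|.

Lemma compress S i c r A :
    i \in S -> shadow_optimal (S :\ i) -> A \subset slice S c r ->
  exists A', [/\ A' \subset slice S c r, #|A'| = #|A|, #|shad S A'| <= #|shad S A|,
    forall v, initial (slice (S :\ i) (upd c i v) r) (section A' i v)
    & A' = A \/ wt A' < wt A].
Proof.
move=> iS IH AL; have secL v := section_slice i v AL.
have [J JP] := fin_all_exists (fun v => initial_exists (subset_leq_card (secL v))).
have Jv v x : x \in J v -> x i = v.
  have [[/subsetP JL _] _] := JP v; case/JL/sliceP=> _ /(_ i) ->.
    by rewrite upd_same.
  by rewrite !inE eqxx.
pose A' := \bigcup_v J v; have secA' v : section A' i v = J v.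
  apply/setP=> x; rewrite inE; apply/andP/idP => [[/bigcupP[v' _ xJ] /eqP]|xJ].
    by rewrite (Jv _ _ xJ) => <-.
  by rewrite (Jv _ _ xJ) eqxx; split=> //; apply/bigcupP; exists v.
exists A'; split.
- apply/bigcupsP=> v _; apply/subsetP=> x xJ.
  have [[/subsetP JL _] _] := JP v; case/sliceP: (JL x xJ) => rx Hx.
  apply/sliceP; split=> // j jS; have ji : j != i by apply: contraNneq jS => ->.
  by rewrite Hx ?upd_neq // !inE negb_and jS orbT.
- rewrite (card_sections A' i) (card_sections A i); apply: eq_bigr => v _.
  by rewrite secA'; case: (JP v).
(* A shadow section at a non-zero value comes only from the section at that value, where optimality
   for [S :\ i] applies. At value 0 all sections contribute, and after compression the contributions
   are nested initial segments. *)
- rewrite (card_sections _ i) [X in _ <= X](card_sections _ i).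
  apply: leq_sum => v _; case: (posnP v) => [v0|v0]; last first.
    by rewrite !section_shad // secA'; case: (JP v) => Ji cJ; apply: IH cJ.
  have {v v0} -> : v = ord0 by apply: val_inj.
  rewrite !section_shad0 //.
  apply: (@card_bigcup_initial _ (slice (S :\ i) (upd c i ord0) r.-1)) => v.
    rewrite /shad_part secA'; case: (JP v) => Ji cJ.
    case: eqP => [vE|/eqP v0]; first by rewrite vE in Ji *; apply: initial_shad.
    by apply: initial_upd0 Ji; rewrite ?lt0n // !inE eqxx.
  rewrite /shad_part secA'; case: (JP v) => Ji cJ; case: eqP => [vE|/eqP v0].
    by apply: IH cJ.
  have cI B : (forall x, x \in B -> x i = v) -> #|[set upd x i ord0 | x in B]| = #|B|.
    move=> Bi; apply: card_in_imset => x y /Bi xi /Bi yi E.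
    by rewrite -(upd_id x i) -(upd_id y i) xi yi -(upd_upd x i ord0) E upd_upd.
  rewrite !cI ?cJ // => x; last exact: Jv.
  by case/setIdP=> _ /eqP.
- by move=> v; rewrite secA'; case: (JP v).
(* If some section changes, it strictly loses weight while no other section gains any. *)
case: (boolP [forall v, J v == section A i v]) => [/forallP JA|].
  left; apply/setP=> x; have := secA' (x i); have /eqP -> := JA (x i).
  by move/setP/(_ x); rewrite !inE eqxx !andbT.
rewrite negb_forall => /existsP[v0 Jv0]; right.
rewrite (wt_sections A' i) (wt_sections A i) (bigD1 v0) //= [X in _ < X](bigD1 v0) //=.
rewrite -addSn; apply: leq_add.
  rewrite secA'; case: (JP v0) => Ji cJ; apply: initial_wt Ji _ _ _ => //.
  by rewrite eq_sym.
apply: leq_sum => v _; rewrite secA'; case: (JP v) => Ji cJ.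
have [->//|nE] := eqVneq (section A i v) (J v).
by apply/ltnW; apply: initial_wt Ji _ _ _.
Qed.

(** * Exchanges in compressed sets *)

Definition supp S x : {set 'I_n} := [set j in S | 0 < x j].

Lemma card_supp_slice S c r x y :
  x \in slice S c r -> y \in slice S c r -> #|supp S x| = #|supp S y|.
Proof.
case/sliceP=> rx Hx /sliceP[ry Hy].
have split_rank z : rank z = #|supp S z| + #|[set j | (0 < z j) && (j \notin S)]|.
  rewrite /rank -[LHS](cardsID S); congr (_ + _);
    by apply: eq_card => j; rewrite !inE // andbC.
have: #|[set j | (0 < x j) && (j \notin S)]| = #|[set j | (0 < y j) && (j \notin S)]|.
  apply: eq_card => j; rewrite !inE; case: (boolP (j \in S)); rewrite ?andbF //.
  by move=> jS; rewrite Hx ?Hy.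
by have := split_rank x; have := split_rank y; lia.
Qed.

(** All points of the slice have equally many non-zero free coordinates. If there is at most one,
    only the point with all free coordinates zero can occur in a shadow, and it occurs for [A]
    whenever it does for [B]. *)
Lemma shad_rank1 S c r A B y :
    A \subset slice S c r -> B \subset slice S c r -> #|B| = #|A| ->
    y \in slice S c r -> #|supp S y| <= 1 ->
  #|shad S B| <= #|shad S A|.
Proof.
move=> /subsetP AL /subsetP BL cBA yL y1.
have [->|[u /shadP[b [j [bB jS bj _]]]]] := set_0Vmem (shad S B).
  by rewrite cards0.
have uniq_shad u' : u' \in shad S B -> u' = [ffun l => if l \in S then ord0 else c l].
  case/shadP=> b' [j' [b'B j'S b'j' ->]]; apply/ffunP=> l; rewrite updE ffunE.
  have /sliceP[_ Hb'] := BL _ b'B.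
  case: (eqVneq l j') => [->|lj']; first by rewrite j'S.
  case: (boolP (l \in S)) => [lS|]; last exact: Hb'.
  apply/val_inj/eqP; rewrite /= -leqn0 leqNgt; apply/negP=> b'l.
  move: y1; rewrite -(card_supp_slice (BL _ b'B) yL) leqNgt => /negP; apply.
  by apply/card_gt1P; exists l, j'; rewrite !inE lS b'l j'S b'j'.
apply: (@leq_trans 1).
  by apply/card_le1_eqP=> u1 u2 /uniq_shad -> /uniq_shad ->.
have /card_gt0P[a aA] : 0 < #|A| by rewrite -cBA; apply/card_gt0P; exists b.
have : 0 < #|supp S a|.
  rewrite (card_supp_slice (AL _ aA) (BL _ bB)).
  by apply/card_gt0P; exists j; rewrite inE jS.
case/card_gt0P=> l; rewrite inE => /andP[lS al]; apply/card_gt0P.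
by exists (upd a l ord0); apply: mem_shad.
Qed.

(* The points of the shadow of x that do not lie in the shadow of any smaller
   point are the [upd x l 0] with l in [ones S x]. *)
Definition ones S x : {set 'I_n} :=
  [set l in S | (x l == 1 :> nat) && [forall l' in S, (l' < l) ==> (0 < x l')]].

Lemma onesP S x l :
  reflect [/\ l \in S, x l = 1 :> nat & forall l', l' \in S -> l' < l -> 0 < x l']
          (l \in ones S x).
Proof.
rewrite inE; apply: (iffP and3P).
  case=> lS /eqP xl /forall_inP Hl; split=> // l' /Hl/implyP; exact.
case=> lS xl Hl; split=> //; first exact/eqP.
by apply/forall_inP=> l' l'S; apply/implyP; apply: Hl.
Qed.

Definition new_shad S x : {set pt} := [set upd x l ord0 | l in ones S x].

Lemma card_new_shad S x : #|new_shad S x| = #|ones S x|.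
Proof.
apply: card_in_imset => l l' /onesP[_ xl _] _ E; apply/eqP/negPn/negP => ll'.
have := congr1 (fun z : pt => val (z l)) E.
by rewrite /= upd_same upd_neq // xl.
Qed.

Lemma key_move y l j :
    y l = ord0 -> lexlt 1 l (y j) j -> key (upd (upd y l one_k) j ord0) < key y.
Proof.
move=> yl lt1; have yj : 0 < y j by move: lt1; rewrite /lexlt; lia.
have lj : l != j by apply: contraTneq yj => <-; rewrite yl.
have := key_upd y l one_k; have := key_upd (upd y l one_k) j ord0.
rewrite upd_neq 1?eq_sym // yl (one_kE yj).
have : weight l 1 < weight j (y j) by apply: weight_lt lt1.
have -> : weight l (@ord0 k) = 0 by rewrite /weight.
by have -> : weight j (@ord0 k) = 0 by []; lia.
Qed.

Lemma slice_move S c r y l j :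
    y \in slice S c r -> l \in S -> j \in S -> y l = ord0 -> 0 < y j ->
  upd (upd y l one_k) j ord0 \in slice S c r.
Proof.
move=> yL lS jS yl yj; have lj : l != j by apply: contraTneq yj => <-; rewrite yl.
apply: (slice_upd (r := r.+1)) => //.
  by apply: (slice_upd yL) => //; rewrite yl (one_kE yj) addn0 addn1.
by rewrite upd_neq 1?eq_sym // yj addn1 addn0.
Qed.

Section Exchange.

Variables (S : {set 'I_n}) (c : pt) (r : nat) (A : {set pt}) (x y : pt).
Hypotheses (AL : A \subset slice S c r) (xL : x \in slice S c r) (xA : x \notin A).
Hypothesis x_min : forall z, z \in slice S c r -> key z < key x -> z \in A.
Hypotheses (yA : y \in A) (y_max : forall z, z \in A -> key z <= key y).
Hypothesis lt_xy : key x < key y.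

Let yL : y \in slice S c r. Proof. exact: (subsetP AL). Qed.

Lemma swap_shad : #|ones S x| <= #|ones S y| ->
  #|shad S ((A :\: [set y]) :|: [set x])| <= #|shad S A|.
Proof.
move=> le_ones; have Ey : new_shad S y \subset shad S A.
  by apply/subsetP=> _ /imsetP[l /onesP[lS yl _] ->]; apply: mem_shad; rewrite ?yl.
(* Another point [z] of [A] above [upd y l ord0] would have a larger key than [y]: either [j = l]
   and [z l > 1], or [j] is another zero of [y], and no free zero of [y] precedes [l]. *)
have old z j : z \in A -> z != y -> j \in S -> 0 < z j ->
    upd z j ord0 \in shad S A :\: new_shad S y.
  move=> zA zy jS zj; rewrite in_setD mem_shad // andbT.
  apply/imsetP=> -[l /onesP[lS yl yrun] E].
  have Eq q : q != j -> q != l -> z q = y q.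
    by move=> qj ql; have := congr1 (fun u : pt => u q) E; rewrite !upd_neq.
  have := y_max zA; apply/negP; rewrite -ltnNge.
  have := key_upd z j ord0; have := key_upd y l ord0; rewrite -E yl.
  have w0 q : weight q (@ord0 k) = 0 by [].
  rewrite !w0 !addn0 => <- <-; rewrite ltn_add2l; apply: weight_lt => //.
  have [jl|jl] := eqVneq j l.
    rewrite /lexlt jl ltnn andbF orbF ltn_neqAle -{2}jl zj andbT.
    apply: contraNneq zy => zl; apply/eqP/ffunP=> q; case: (eqVneq q j) => [->|qj].
      by apply: val_inj; rewrite /= jl -zl yl.
    by apply: Eq => //; rewrite -jl.
  have yj : y j = ord0.
    by have := congr1 (fun u : pt => u j) E; rewrite upd_same upd_neq.
  have : ~~ (j < l) by apply/negP=> /(yrun _ jS); rewrite yj.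
  by move: zj jl; rewrite /lexlt -val_eqE /=; clear; lia.
have sub : shad S ((A :\: [set y]) :|: [set x]) \subset
    (shad S A :\: new_shad S y) :|: new_shad S x.
  apply/subsetP=> _ /shadP[z [j [zA' jS zj ->]]]; rewrite in_setU.
  case/setUP: zA' => [/setDP[zA]|/set1P zx]; first by rewrite in_set1 => zy; rewrite old.
  rewrite {z}zx in zj *; case: (boolP (j \in ones S x)) => [jo|].
    by rewrite [X in _ || X](imset_f (fun l => upd x l ord0)) ?orbT.
  have lower z : z \in slice S c r -> key z < key x -> z \in A /\ z != y.
    move=> zL zx; split; first exact: x_min.
    by apply: contraTneq (ltn_trans zx lt_xy) => ->; rewrite ltnn.
  have x1 := one_kE zj.
  (* For [j] outside [ones S x], the shadow point also lies below a smaller point, which is in [A]: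
     lower [x j] to 1 or, if it is 1 already, move this 1 to an earlier zero. *)
  move=> jno; case: (ltngtP 1 (x j)) => [xj2|xj0|xj1]; first 1 last.
  - by move: zj xj0; clear; lia.
  - have [l lS /andP[lj /eqP xl]] : exists2 l, l \in S & (l < j) && (x l == ord0).
      apply/exists_inP; apply: contraNT jno; rewrite negb_exists_in.
      move=> /forall_inP Hn; apply/onesP; split=> // l lS lj.
      by move: (Hn l lS); rewrite lj -val_eqE /= lt0n.
    have lt1 : lexlt 1 l (x j) j by rewrite /lexlt -xj1 eqxx lj.
    have ljn : l != j by rewrite neq_ltn lj.
    have [zA zy] := lower _ (slice_move xL lS jS xl zj) (key_move xl lt1).
    have -> : upd x j ord0 = upd (upd (upd x l one_k) j ord0) l ord0.
      by rewrite updC 1?eq_sym // upd_upd -xl upd_id.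
    by rewrite old // upd_neq // upd_same x1.
  - have zL : upd x j one_k \in slice S c r.
      by apply: (slice_upd xL jS); rewrite zj x1.
    have zlt : key (upd x j one_k) < key x.
      have := key_upd x j one_k; have := weight_ltv j j xj2; rewrite x1.
      by clear; lia.
    have [zA zy] := lower _ zL zlt.
    by rewrite -(upd_upd x j one_k) old // upd_same x1.
apply: (leq_trans (subset_leq_card sub)); apply: (leq_trans (leq_card_setU _ _)).
rewrite cardsD (setIidPr Ey) !card_new_shad.
by have := subset_leq_card Ey; rewrite card_new_shad; lia.
Qed.

(** This is stability under compression: each section of [A] at a free coordinate is initial. *)
Hypothesis A_closed : forall w z j, j \in S -> z \in A -> w \in slice S c r ->
  w j = z j -> key w <= key z -> w \in A.

Let disj j : j \in S -> x j != y j.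
Proof.
move=> jS; apply: contra xA => /eqP xyj.
by apply: (A_closed jS yA xL xyj); exact: ltnW.
Qed.

(** This describes the case where the plain swap may enlarge the shadow. The method is to lower [y]
    away from the decisive coordinate [i] until it agrees with [x] somewhere on [S], which [nosub]
    forbids. *)
Lemma swap_or_box : 1 < #|supp S y| -> #|ones S y| < #|ones S x| ->
  exists i, [/\ i \in S, x i = 1 :> nat,
    forall j, j \in S -> j != i -> (1 < y j) && (y j < x j)
    & forall j, j \in S -> lexlt (x j) j (y i) i].
Proof.
move=> y2 lt_ones.
have [i [xyi yi0 iT _]] := key_top lt_xy.
have /sliceP[_ Hx] := xL; have /sliceP[_ Hy] := yL.
have iS : i \in S by apply: contraNT xyi => iS; rewrite Hx ?Hy.
(* Such a z would be in A, as it agrees with y at i; being above x, it would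
   then put x in A, as it agrees with x at j. *)
have nosub z j : z \in slice S c r -> z i = y i -> j \in S -> z j = x j ->
    key z < key y -> False.
  move=> zL zi jS zj zy; have zA := A_closed iS yA zL zi (ltnW zy).
  case/negP: xA; apply: (A_closed jS zA xL (esym zj)); apply/ltnW.
  apply: (@key_lt_top _ _ i); rewrite ?zi // => q xzq.
  have /sliceP[_ Hz] := zL.
  have qS : q \in S by apply: contraNT xzq => qS; rewrite Hx ?Hz.
  exact: iT (disj qS).
have one_kY := one_kE yi0.
have card_eq := card_supp_slice xL yL.
have yNS q : q \in S -> y q = ord0 -> #|supp S y| < #|S|.
  move=> qS yq; apply: proper_card; apply/properP; split.
    by apply/subsetP=> l /setIdP[].
  by exists q; rewrite // inE yq andbF.
have [l /andP[lo li]|only_i] := pickP [pred l | (l \in ones S x) && (l != i)].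
  (* Suppose [ones S x] has a member other than [i]. At such a place a value of [y] above 1 could be
     lowered to 1, and if [y] vanishes there, a non-zero value elsewhere that outweighs this 1 could
     be traded for it. *)
  exfalso; have shape l1 : l1 \in ones S x -> l1 != i -> y l1 = ord0 /\
      forall j, j \in S -> j != i -> 0 < y j -> y j = 1 :> nat /\ j < l1.
    move=> /onesP[l1S xl1 _] l1i; have il1 : i != l1 by rewrite eq_sym.
    have yl1 : y l1 = ord0.
      apply/val_inj/eqP; rewrite /= -leqn0 leqNgt; apply/negP=> yl1.
      have yl1_gt1 : 1 < y l1.
        move: (disj l1S) yl1; rewrite -val_eqE /= xl1; clear; lia.
      apply: (nosub (upd y l1 one_k) l1) => //.
      - by apply: (slice_upd yL l1S); rewrite yl1 one_kY.
      - by rewrite upd_neq.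
      - by rewrite upd_same; apply: val_inj; rewrite /= one_kY.
      - have := key_upd y l1 one_k; have := weight_ltv l1 l1 yl1_gt1.
        by rewrite one_kY; clear; lia.
    split=> // j jS ji yj; have jl1 : j != l1 by apply: contraTneq yj => ->; rewrite yl1.
    have nlex : ~~ lexlt 1 l1 (y j) j.
      apply/negP=> lex1; apply: (nosub (upd (upd y l1 one_k) j ord0) l1) => //.
      - exact: slice_move.
      - by rewrite !upd_neq // eq_sym.
      - by rewrite upd_neq 1?eq_sym // upd_same; apply: val_inj; rewrite /= one_kY.
      - exact: key_move.
    by move: nlex yj jl1; rewrite /lexlt -val_eqE /=; clear; lia.
  have [yl yshape] := shape l lo li; have /onesP[lS xl xrun] := lo.
  have [j0 [j0S j0i yj0]] : exists j0, [/\ j0 \in S, j0 != i & 0 < y j0].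
    have [j1 [j2 []]] := card_gt1P y2; rewrite !inE => /andP[j1S yj1] /andP[j2S yj2] j12.
    by have [j1i|j1i] := eqVneq j1 i; [exists j2; rewrite -j1i eq_sym | exists j1].
  have [yj0_1 j0l] := yshape j0 j0S j0i yj0.
  (* Now the supports are pinned down: on [S], [x] vanishes exactly at [i] and, the supports having
     equal size, [y] exactly at [l]. *)
  have x_zero q : q \in S -> x q = ord0 -> q = i.
    move=> qS xq; apply/eqP/negPn/negP=> qi; have := disj qS.
    rewrite xq eq_sym -val_eqE /= -lt0n => yq; have [_ ql] := yshape q qS qi yq.
    by have := xrun q qS ql; rewrite xq.
  have xi : x i = ord0.
    apply/val_inj/eqP; rewrite /= -leqn0 leqNgt; apply/negP=> xi.
    have := yNS l lS yl; rewrite -card_eq ltnNge => /negP; apply.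
    apply/subset_leq_card/subsetP=> q qS; rewrite inE qS lt0n; apply/negP=> /eqP xq.
    by move: xi; rewrite -(x_zero q qS) ?xq //; apply: val_inj.
  have y_pos q : q \in S -> q != l -> 0 < y q.
    move=> qS ql; have sub_y : supp S y \subset S :\ l.
      apply/subsetP=> j /setIdP[jS yj]; rewrite in_setD1 jS andbT.
      by apply: contraTneq yj => ->; rewrite yl.
    have /eqP supp_y : supp S y == S :\ l.
      rewrite eqEcard sub_y -card_eq; apply: (@leq_trans #|S :\ i|).
        by have := cardsD1 l S; rewrite {1}(cardsD1 i S) lS iS => /addnI->.
      apply/subset_leq_card/subsetP=> j /setD1P[ji jS]; rewrite inE jS lt0n.
      by apply: contra ji => /eqP xj; apply/eqP/x_zero => //; apply: val_inj.
    have : q \in supp S y by rewrite supp_y in_setD1 ql.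
    by case/setIdP.
  (* Each member of [ones S x] is a zero of [y], hence is [l]; but [j0] lies in [ones S y], against
     [lt_ones]. *)
  have : #|ones S x| <= 1.
    rewrite -(cards1 l); apply/subset_leq_card/subsetP=> l1 l1o; rewrite in_set1.
    have /onesP[l1S xl1 _] := l1o.
    have l1i : l1 != i by apply: contra_eqN xl1 => /eqP->; rewrite xi.
    have [yl1 _] := shape l1 l1o l1i; apply: contraT => l1l.
    by have := y_pos l1 l1S l1l; rewrite yl1.
  rewrite leqNgt => /negP; apply; apply: leq_ltn_trans lt_ones.
  apply/card_gt0P; exists j0; apply/onesP; split=> // l' l'S l'j0; apply: y_pos => //.
  by apply: contraTneq l'j0 => ->; rewrite -leqNgt ltnW.
have ones_x : ones S x = [set i].
  apply/eqP; rewrite eqEcard cards1 (leq_ltn_trans _ lt_ones) // andbT.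
  apply/subsetP=> l lo; rewrite in_set1; apply/negPn/negP=> li.
  by have := only_i l; rewrite /= lo li.
have no_ones_y l : l \notin ones S y.
  have : #|ones S y| == 0 by move: lt_ones; rewrite ones_x cards1; clear; lia.
  by rewrite cards_eq0 => /eqP->; rewrite in_set0.
have /onesP[_ xi xrun] : i \in ones S x by rewrite ones_x set11.
have not1 l : l \in S -> (forall l', l' \in S -> l' < l -> 0 < y l') -> y l != 1 :> nat.
  by move=> lS Hl; apply: contra (no_ones_y l) => /eqP yl; apply/onesP.
(* If [x q = 0], moving the value of [y] at [q] to a zero of [y] would give a point agreeing with
   [x] at [q]. Hence [y q = 1] and [q] precedes all free zeros of [y], so [q] would be in the empty
   set [ones S y]. *)
have x_pos q : q \in S -> 0 < x q.
  move=> qS; rewrite lt0n; apply/negP=> /eqP xq0; have xq : x q = ord0 by apply: val_inj.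
  have qi : q != i by apply: contra_eqN xi => /eqP<-; rewrite xq.
  have yq : 0 < y q by have := disj qS; rewrite xq eq_sym -val_eqE /= -lt0n.
  have zero_y p : p \in S -> y p = ord0 -> (y q == 1 :> nat) && (q < p).
    move=> pS yp; have ip : i != p by apply: contraTneq yi0 => ->; rewrite yp.
    have pq : p != q by apply: contraTneq yq => <-; rewrite yp.
    have : ~~ lexlt 1 p (y q) q.
      apply/negP=> lex1; apply: (nosub (upd (upd y p one_k) q ord0) q) => //.
      - exact: slice_move.
      - by rewrite !upd_neq // eq_sym.
      - by rewrite upd_same.
      - exact: key_move.
    by move: yq pq; rewrite /lexlt -val_eqE /=; clear; lia.
  have [p pS /eqP yp] : exists2 p, p \in S & y p == ord0.
    apply/exists_inP; apply: contraT; rewrite negb_exists_in => /forall_inP Hn.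
    have : #|supp S x| < #|S|.
      apply: proper_card; apply/properP; split; first by apply/subsetP=> l /setIdP[].
      by exists q; rewrite // inE xq andbF.
    rewrite card_eq ltnNge => /negP[]; apply/subset_leq_card/subsetP=> p pS.
    by rewrite inE pS lt0n; apply: Hn.
  have /andP[yq1 _] := zero_y p pS yp.
  suff : y q != 1 :> nat by rewrite yq1.
  apply: (not1 q qS) => l' l'S l'q; rewrite lt0n; apply/negP=> /eqP yl'.
  have yl'0 : y l' = ord0 by apply: val_inj.
  have /andP[_] := zero_y l' l'S yl'0.
  by rewrite ltnNge ltnW.
have y_pos q : q \in S -> 0 < y q.
  move=> qS; rewrite lt0n; apply/negP=> /eqP yq0.
  have yq : y q = ord0 by apply: val_inj.
  have := yNS q qS yq.
  rewrite -card_eq ltnNge => /negP[]; apply/subset_leq_card/subsetP=> p pS.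
  by rewrite inE pS x_pos.
exists i; split=> // j jS; last exact: iT (disj jS).
move=> ji; have yj1 : 1 < y j.
  by move: (not1 j jS (fun l' l'S _ => y_pos l' l'S)) (y_pos j jS); clear; lia.
rewrite yj1 /= ltnNge leq_eqVlt negb_or val_eqE disj //=.
apply/negP=> lt_j; apply: (nosub (upd y j (x j)) j) => //.
- by apply: (slice_upd yL jS); rewrite x_pos // y_pos.
- by rewrite upd_neq // eq_sym.
- by rewrite upd_same.
- have := key_upd y j (x j); have := weight_ltv j j lt_j.
  by clear; lia.
Qed.

Lemma box_exchange i p :
    i \in S -> p \in S -> p != i -> x i = 1 :> nat ->
    (forall j, j \in S -> j != i -> (1 < y j) && (y j < x j)) ->
    (forall j, j \in S -> j != i -> y p <= y j) ->
    (forall j, j \in S -> lexlt (x j) j (y i) i) ->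
  exists X Y, [/\ [/\ Y \subset A, [disjoint X & A], #|X| = #|Y| & 0 < #|Y|],
    X \subset slice S c r,
    forall z z', z \in X -> z' \in Y -> key z < key z'
    & #|shad S ((A :\: Y) :|: X)| <= #|shad S A|].
Proof.
move=> iS pS pi xi big pmin low.
have /sliceP[_ Hx] := xL; have /sliceP[_ Hy] := yL.
(* The bound [y p] is what both sides require: all points of [A] above [upd y p ord0] must be
   removed for it to leave the shadow, while the values inserted at [i] must stay below every [x j]
   with [j != i]. *)
pose W := [set w : 'I_k.+1 | (0 < w) && (w <= y p)].
have [yp1 yxp] : 1 < y p /\ y p < x p by apply/andP; apply: big.
have xip : i != p by rewrite eq_sym.
have oneW : one_k \in W by rewrite inE (@one_kE (y p)) ?(ltnW yp1) // ltnW.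
have yi_gt : y p < y i.
  by move: (low p pS) yxp; rewrite /lexlt; clear; lia.
pose X := [set upd x i w | w in W]; pose Y := [set upd y p w | w in W].
have memA z : z \in slice S c r -> z p = x p -> key x <= key z -> z \notin A.
  move=> zL zp xz; apply: contra xA => zA.
  exact: (A_closed pS zA xL (esym zp)).
have injX : #|X| = #|W|.
  by apply: card_imset => w w' /(congr1 (fun z : pt => z i)); rewrite !upd_same.
have injY : #|Y| = #|W|.
  by apply: card_imset => w w' /(congr1 (fun z : pt => z p)); rewrite !upd_same.
have XL : X \subset slice S c r.
  apply/subsetP=> _ /imsetP[w + ->]; rewrite inE => /andP[w0 _].
  by apply: (slice_upd xL iS); rewrite xi w0.
have YA : Y \subset A.
  apply/subsetP=> _ /imsetP[w + ->]; rewrite inE => /andP[w0 wy].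
  apply: (A_closed iS yA).
  - by apply: (slice_upd yL pS); rewrite w0 (ltnW yp1).
  - by rewrite upd_neq.
  - have := key_upd y p w; suff: weight p w <= weight p (y p) by clear; lia.
    move: wy; rewrite leq_eqVlt => /orP[/eqP->//|wy].
    exact/ltnW/weight_ltv.
have w0 q : weight q (@ord0 k) = 0 by [].
exists X, Y; split=> //.
- split=> //; first 1 last.
  + by rewrite injX injY.
  + by rewrite injY; apply/card_gt0P; exists one_k.
  rewrite -setI_eq0; apply/eqP/setP=> z; rewrite in_set0 in_setI.
  apply/negP=> /andP[/imsetP[w wW ->]]; apply/negP; apply: memA.
  + by apply: (subsetP XL); apply: imset_f.
  + by rewrite upd_neq // eq_sym.
  + have := key_upd x i w; rewrite xi; suff: weight i 1 <= weight i w by clear; lia.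
    move: wW; rewrite inE => /andP[]; rewrite leq_eqVlt => /orP[/eqP<-//|w2 _].
    exact/ltnW/weight_ltv.
- move=> _ _ /imsetP[w wW ->] /imsetP[w' w'W ->].
  move: wW; rewrite inE => /andP[w0' wp].
  have wi : w < y i by apply: leq_ltn_trans yi_gt.
  apply: (@key_lt_top _ _ i); rewrite ?upd_same (@upd_neq y p w' i) //.
  + by apply: contraTneq wi => ->; rewrite ltnn.
  + by apply: leq_ltn_trans yi_gt.
  move=> q; case: (eqVneq q i) => [->|qi]; first by rewrite upd_same /lexlt wi.
  rewrite (upd_neq x) //; case: (boolP (q \in S)) => [qS _|qS]; first exact: low.
  have qp : q != p by apply: contraNneq qS => ->.
  by rewrite upd_neq // Hx // Hy // eqxx.
have y_pos q : q \in S -> 0 < y q.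
  move=> qS; have [->|qi] := eqVneq q i; first exact: leq_ltn_trans yi_gt.
  by case/andP: (big q qS qi) => /ltnW.
pose y0 := upd y p ord0; pose x0 := upd x i ord0.
have y0d : y0 \in shad S A by apply: mem_shad; rewrite // ltnW.
(* Since [y] has no free zero, a point of [A] above [y0] is [y] changed at [p] only. Outside [Y] its
   value there would exceed [y p], against the maximality of [y]. *)
have old z j : z \in A -> z \notin Y -> j \in S -> 0 < z j ->
    upd z j ord0 \in shad S A :\ y0.
  move=> zA zY jS zj; rewrite in_setD1 mem_shad // andbT.
  apply: contra zY => /eqP E.
  have jp : j = p.
    apply/eqP/negPn/negP=> jp; have := y_pos j jS.
    by have := congr1 (fun u : pt => u j) E; rewrite upd_same upd_neq // => <-.
  move: E; rewrite jp => E.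
  have zE : z = upd y p (z p) by rewrite -[LHS](upd_id z p) -(upd_upd z p ord0) E upd_upd.
  rewrite zE; apply: imset_f; rewrite inE -{1}jp zj /= leqNgt; apply/negP => ypz.
  have := y_max zA; rewrite zE; have := key_upd y p (z p); have := weight_ltv p p ypz.
  by clear; lia.
have sub : shad S ((A :\: Y) :|: X) \subset x0 |: (shad S A :\ y0).
  apply/subsetP=> _ /shadP[z [j [zA' jS zj ->]]]; rewrite in_setU1.
  case/setUP: zA' => [/setDP[zA zY]|/imsetP[w wW zE]]; first by rewrite old ?orbT.
  have [ji|ji] := eqVneq j i; first by rewrite zE ji upd_upd eqxx.
  move: wW; rewrite inE => /andP[w0' wp].
  have wi : w < y i by apply: leq_ltn_trans yi_gt.
  have [yj1 yxj] : 1 < y j /\ y j < x j by apply/andP; apply: big.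
  have wxj : w < x j by apply: leq_ltn_trans yxj; apply: (leq_trans wp); apply: pmin.
  have zj_eq : z j = x j by rewrite zE upd_neq.
  have z'L : upd z j one_k \in slice S c r.
    apply: (slice_upd _ jS); first by rewrite zE; apply: (subsetP XL); rewrite imset_f // inE w0'.
    by rewrite zj (one_kE zj).
  (* As [w <= y p <= y j < x j], lowering [x j] to 1 outweighs raising the 1 at [i] to [w], so this
     point precedes [x]. *)
  have z'A : upd z j one_k \in A.
    apply: (x_min z'L); have := key_upd z j one_k; have := key_upd x i w.
    rewrite -zE zj_eq xi (one_kE zj).
    suff : weight i w + weight j 1 < weight i 1 + weight j (x j) by clear; lia.
    case: (ltngtP 1 w) => [w2|w_lt1|<-]; last by rewrite ltn_add2l weight_ltv // (ltn_trans yj1).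
    - apply: ltn_addl; rewrite addnC; apply: (@weight_add_lt 1 w) => //.
      + by rewrite /lexlt w2.
      + by rewrite /lexlt wxj.
    - by move: w0' w_lt1; clear; lia.
  have z'Y : upd z j one_k \notin Y.
    apply/imsetP=> -[w' _ /(congr1 (fun u : pt => val (u i)))] /=.
    by rewrite !upd_neq // 1?eq_sym // zE upd_same => E; move: wi; rewrite E ltnn.
  by rewrite -(upd_upd z j one_k) old ?orbT // upd_same (one_kE zj).
apply: (leq_trans (subset_leq_card sub)); apply: (leq_trans (leq_card_setU _ _)).
by rewrite cards1 [X in _ <= X](cardsD1 y0) y0d.
Qed.

End Exchange.

(** * Descent on the sum of the keys *)

(** If no set of smaller weight does as well, compression returns [A] itself. A missing point below
    a present one would then permit a swap or a box exchange, and both lower the weight. *)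
Lemma descent_step S c r A :
    (forall i, i \in S -> shadow_optimal (S :\ i)) -> A \subset slice S c r ->
    (forall z, z \in slice S c r -> 1 < #|supp S z|) ->
  initial (slice S c r) A \/ exists A', [/\ A' \subset slice S c r, #|A'| = #|A|,
    #|shad S A'| <= #|shad S A| & wt A' < wt A].
Proof.
move=> IH AL supp2; pose better A' := [&& A' \subset slice S c r, #|A'| == #|A|,
  #|shad S A'| <= #|shad S A| & wt A' < wt A].
have [A' /and4P[A'L /eqP cA' sA' wA']|none] := pickP better; first by right; exists A'.
left; have closed w z j : j \in S -> z \in A -> w \in slice S c r ->
    w j = z j -> key w <= key z -> w \in A.
  move=> jS zA wL wz kwz; have [A' [A'L cA' sA' A'i A'A]] := compress jS (IH j jS) AL.
  case: A'A => [A'A|A'A]; last by have := none A'; rewrite /better A'L cA' eqxx sA' A'A.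
  have [_ init] := A'i (z j); rewrite A'A in init.
  have : w \in section A j (z j).
    apply: (init _ z) => //; first by rewrite inE zA /=.
    apply: (subsetP (section_slice j (z j) (subxx (slice S c r)))).
    by apply/setIdP; rewrite wz.
  by case/setIdP.
split=> // x0 y0 y0A x0L kxy0; apply: contraT => x0A; exfalso.
have [x [xL xA x_min kx]] : exists x, [/\ x \in slice S c r, x \notin A,
    forall z, z \in slice S c r -> key z < key x -> z \in A & key x <= key x0].
  have x0D : x0 \in slice S c r :\: A by rewrite in_setD x0A.
  pose x := [arg min_(x < x0 in slice S c r :\: A) key x].
  have [/setDP[xL xA] xM] : x \in slice S c r :\: A /\
      forall z, z \in slice S c r :\: A -> key x <= key z.
    by rewrite /x; case: arg_minnP.
  exists x; split=> //; last exact: xM.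
  move=> z zL; apply: contraTT => zA; rewrite -leqNgt; apply: xM.
  by rewrite in_setD zA.
have [y [yA y_max ky]] : exists y, [/\ y \in A, forall z, z \in A -> key z <= key y
    & key y0 <= key y].
  pose y := [arg max_(y > y0 in A) key y].
  have [yA yM] : y \in A /\ forall z, z \in A -> key z <= key y.
    by rewrite /y; case: arg_maxnP.
  by exists y; split=> //; apply: yM.
have ltxy : key x < key y.
  rewrite ltn_neqAle (leq_trans kx (leq_trans kxy0 ky)) andbT.
  by apply: contraNneq xA => /key_inj->.
have yL := subsetP AL _ yA.
suff [X [Y [[YA dXA cXY Y0] XL lt_XY sXY]]] : exists X Y,
  [/\ [/\ Y \subset A, [disjoint X & A], #|X| = #|Y| & 0 < #|Y|],
      X \subset slice S c r,
      forall z z', z \in X -> z' \in Y -> key z < key z'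
      & #|shad S ((A :\: Y) :|: X)| <= #|shad S A|].
  have := none ((A :\: Y) :|: X); rewrite /better exchange_card // eqxx sXY exchange_wt //.
  by rewrite subUset XL (subset_trans (subsetDl _ _) AL).
case: (leqP #|ones S x| #|ones S y|) => [le_ones|lt_ones].
  exists [set x], [set y]; split.
  - by rewrite sub1set yA disjoints1 xA !cards1.
  - by rewrite sub1set.
  - by move=> z z' /set1P-> /set1P->.
  - exact: (swap_shad (c := c) (r := r)).
have [i [iS xi big low]] := swap_or_box AL xL xA yA ltxy closed (supp2 _ yL) lt_ones.
have [p0 p0S] : exists p0, p0 \in S :\ i.
  apply/card_gt0P; have : 1 < #|S|.
    by apply: (leq_trans (supp2 _ yL)); apply/subset_leq_card/subsetP=> l /setIdP[].
  by rewrite (cardsD1 i S) iS ltnS.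
pose p := [arg min_(p < p0 in S :\ i) y p].
have [/setD1P[pi pS] pM] : p \in S :\ i /\ forall q, q \in S :\ i -> y p <= y q.
  by rewrite /p; case: arg_minnP.
apply: (box_exchange AL xL xA x_min yA y_max closed iS pS pi xi big _ low).
by move=> j jS ji; apply: pM; rewrite in_setD1 ji.
Qed.

(** The outer induction is on the number of free coordinates, for all frozen values and ranks at
    once; the inner one is on [wt A]. At most one non-zero free coordinate is a separate case,
    because the exchanges use two. *)
Lemma shadow_optimal_all S : shadow_optimal S.
Proof.
have [m] := ubnP #|S|; elim: m S => // m IHm S; rewrite ltnS => Sm c r A B AL Bi cBA.
have IH i : i \in S -> shadow_optimal (S :\ i).
  by move=> iS; apply: IHm; move: Sm; rewrite (cardsD1 i S) iS.
have [z /andP[zL z1]|supp2] := pickP [pred z | (z \in slice S c r) && (#|supp S z| <= 1)].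
  by case: (Bi) => BL _; apply: shad_rank1 zL z1.
have [w] := ubnP (wt A); elim: w A AL cBA => // w IHw A AL cBA; rewrite ltnS => Aw.
have [z zL|Ai|[A' [A'L cA' sA' wA']]] := descent_step IH AL.
- by have := supp2 z; rewrite /= zL leqNgt /= => /negbFE.
- have sBA : B \subset A by apply: (initial_sub Bi Ai); rewrite cBA.
  have sAB : A \subset B by apply: (initial_sub Ai Bi); rewrite cBA.
  by have -> : B = A by apply/eqP; rewrite eqEsubset sBA.
- apply: leq_trans sA'; apply: IHw => //; first by rewrite cA'.
  exact: leq_trans Aw.
Qed.

(** * Return to the order and the shadow of the statement *)

Lemma key_point_le r x y :
  x \in layer k.+1 n r -> y \in layer k.+1 n r -> key x <= key y -> point_le x y.
Proof.
rewrite !inE => /eqP rx /eqP ry; rewrite leq_eqVlt /point_le.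
case/orP=> [/eqP/key_inj->|ltxy]; first by rewrite eqxx.
have card0 z : #|Rset 0 z| + rank z = n.
  rewrite /rank addnC -[RHS](card_ord n) -(cardsC [set j | 0 < z j]).
  by congr (_ + _); apply: eq_card => j; rewrite !inE lt0n negbK.
have eq0 : #|Rset 0 x| = #|Rset 0 y|.
  by apply/eqP; rewrite -(eqn_add2r r) -{1}rx -ry !card0.
rewrite eq0 eqxx /=; apply/orP; right; apply/orP; right.
have [i [xyi yi0 iT iM]] := key_top ltxy.
have iRy : i \in Rset (y i) y by rewrite inE.
have iRx : i \notin Rset (y i) x by rewrite inE val_eqE.
(* By [iT] and [iM], [y i] is the largest value whose position sets differ, and [i] is the last
   position in their symmetric difference. *)
apply/existsP; exists (y i); apply/and3P; split.
- by apply: contraNneq iRx => ->.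
- apply/forallP=> m; apply/implyP=> ym; apply/eqP/setP=> j; rewrite !inE.
  case: (eqVneq (x j) (y j)) => [->//|xyj].
  by move: (iT j xyj) (iM j xyj) ym; rewrite /lexlt; clear; lia.
apply/existsP; exists i; apply/and3P; split=> //.
  by rewrite in_setU !in_setD iRy iRx orbT.
apply/forallP=> l; apply/implyP.
have [->|xyl] := eqVneq l i; first by [].
rewrite in_setU !in_setD !inE => H; have xyl' : x l != y l.
  by apply: contraTneq H => ->; case: eqP.
move: H (iT l xyl') (iM l xyl') xyl; rewrite /lexlt -val_eqE /=; clear; lia.
Qed.

Lemma dshadowE A : dshadow A = shad setT A.
Proof.
apply/setP=> u; apply/bigcupP/shadP.
  case=> x xA; rewrite inE => /existsP[j /and3P[xj /eqP uj /forallP Hu]].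
  exists x, j; split; rewrite ?in_setT ?lt0n //; apply/ffunP=> l; rewrite updE.
  have [->|lj] := eqVneq l j; first exact: val_inj.
  by apply/eqP; apply: (implyP (Hu l)).
case=> x [j [xA _ xj ->]]; exists x => //; rewrite inE; apply/existsP; exists j.
rewrite -lt0n xj upd_same /=; apply/forallP=> l; apply/implyP=> lj.
by rewrite upd_neq.
Qed.

Lemma layerE c r : layer k.+1 n r = slice setT c r.
Proof.
apply/setP=> x; rewrite inE; apply/eqP/sliceP => [rx|[]//].
by split=> // j; rewrite in_setT.
Qed.

End Star.

Theorem theorem2 (n k r : nat) (n_gt0 : 0 < n) (k_gt0 : 0 < k) (r_le_n : r <= n)
    (A B : {set point k n}) (A_layer : A \subset layer k n r)
    (B_init : initial_segment r B) (card_BA : #|B| = #|A|) :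
  #|dshadow B| <= #|dshadow A|.
Proof.
case: k k_gt0 A B A_layer B_init card_BA => // k _ A B A_layer [B_layer B_init] card_BA.
pose c : point k.+1 n := [ffun=> ord0].
rewrite !dshadowE; apply: (shadow_optimal_all (c := c) (r := r)) => //.
  by rewrite -layerE.
rewrite -layerE; split=> // x y yB xL kxy; apply: (B_init x y) => //.
(* Comparison of keys implies [point_le] on a layer, so initiality for [point_le] yields initiality
   for keys. *)
by apply: key_point_le xL (subsetP B_layer _ yB) kxy.
Qed.
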